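(* Let $\mathscr S=\langle E,S,F,N,g,s\rangle$ be an abstract formal system, and let $A\subseteq F$ and $B\subseteq S$. Suppose that $\mathscr S$ is self-referential with respect to $B$ and that the set $N\setminus g^*A=\{n\in N: g^{-1}(n)\notin A\}$ is $B$-representable. Then $S\cap A\neq B$.
   Context: An abstract formal system is a tuple $\mathscr S=\langle E,S,F,N,g,s\rangle$ such that: (i) $\emptyset\neq S\subseteq F\subseteq E$ and $N$ is a set with $F\cap N=\emptyset$; (ii) $g$ is a one-one map from $F$ onto $N$ (the naming function), with inverse $g^{-1}$; for $H\subseteq F$, $g^*H=\{g(\varphi):\varphi\in H\}$; (iii) $s$ is a map from $F\times N$ into $S$ such that $s(\sigma,n)=\sigma$ for all $\sigma\in S$, $n\in N$; one writes $\varphi[n]$ for $s(\varphi,n)$. For $B\subseteq S$ and $X\subseteq N$, $X$ is $B$-representable if there is $\varphi\in F$ such that for every $n\in N$: $n\in X$ iff $\varphi[n]\in B$. $\mathscr S$ is self-referential with respect to $B$ if for every $X\subseteq N$ which is $B$-representable, the set $\{n\in N: g(g^{-1}(n)[n])\in X\}$ is also $B$-representable. *)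

(* Defs.v *)
From mathcomp Require Import all_boot boolp classical_sets functions.

Set Implicit Arguments.
Unset Strict Implicit.
Unset Printing Implicit Defensive.

Local Open Scope classical_set_scope.

(* E and N are sets in a common universe U, so that the disjointness of F and
   N is meaningful. The maps g : F -> N and s : F x N -> S are total functions
   on U, constrained and used only on F and on F x N respectively. *)
Record formal_system (U : Type) := FormalSystem {
  fsE : set U;
  fsS : set U;
  fsF : set U;
  fsN : set U;
  fsg : U -> U;
  fss : U -> U -> U;
  fsS_neq0 : fsS !=set0;
  fsS_sub_F : fsS `<=` fsF;
  fsF_sub_E : fsF `<=` fsE;
  fsF_disj_N : fsF `&` fsN = set0;
  fsg_bij : set_bij fsF fsN fsg;
  fss_fun : forall phi n, fsF phi -> fsN n -> fsS (fss phi n);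
  fss_id : forall sigma n, fsS sigma -> fsN n -> fss sigma n = sigma
}.

Section Definitions.
Context (U : Type) (Sy : formal_system U).
Local Notation F := (fsF Sy).
Local Notation N := (fsN Sy).
Local Notation g := (fsg Sy).

(* The inverse of the bijection g : F -> N; the default value id is only
   taken outside N. *)
Definition fsg_inv : U -> U := 'pinv_id F g.

(* Meant for B `<=` fsS Sy and X `<=` fsN Sy. *)
Definition representable (B X : set U) : Prop :=
  exists2 phi, F phi & forall n, N n -> (X n <-> B (fss Sy phi n)).

Definition self_referential (B : set U) : Prop :=
  forall X : set U, X `<=` N -> representable B X ->
    representable B [set n | N n /\ X (g (fss Sy (fsg_inv n) n))].

End Definitions.

(* Main.v *)
(** Diagonalization: if [phi] represents the set of [n] with
    [g (g^-1(n)[n])] outside [g^* A], then the sentence [sigma := phi[g phi]]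
    satisfies [sigma \in B] iff [sigma \notin A], so it separates [B] from
    [S `&` A]. *)
Require Import Defs.
From mathcomp Require Import all_boot boolp classical_sets functions.
Local Open Scope classical_set_scope.

Lemma fsg_invK (U : Type) (Sy : formal_system U) (phi : U) :
  fsF Sy phi -> fsg_inv Sy (fsg Sy phi) = phi.
Proof.
move=> Fphi; have [_ ginj _] := fsg_bij Sy.
by apply: (pinvKV _ ginj); rewrite inE.
Qed.

(** Injectivity of [g] on [F] prevents a formula outside [A] from sharing its name with a member of
    [A]. *)
Lemma fsg_in_image (U : Type) (Sy : formal_system U) (A : set U) (phi : U) :
  A `<=` fsF Sy -> fsF Sy phi -> (fsg Sy @` A) (fsg Sy phi) <-> A phi.
Proof.
move=> AF Fphi; have [_ ginj _] := fsg_bij Sy.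
split=> [[psi Apsi gE]|Aphi]; last by exists phi.
by rewrite -(ginj psi phi) // inE //; apply: AF.
Qed.

Theorem mainTheorem2 (U : Type) (Sy : formal_system U) (A B : set U)
    (hA : A `<=` fsF Sy) (hB : B `<=` fsS Sy)
    (hself : self_referential Sy B)
    (hrep : representable Sy B (fsN Sy `\` fsg Sy @` A)) :
  fsS Sy `&` A <> B.
Proof.
have [gN _ _] := fsg_bij Sy.
have [phi Fphi phiP] := hself _ (@subDsetl _ _ _) hrep.
have Nn : fsN Sy (fsg Sy phi) by apply: gN.
(* At [n = g phi], [g^-1(n)[n]] is [phi[g phi]], so the same sentence appears on both sides of the
   equivalence. *)
have := phiP _ Nn; rewrite /= fsg_invK //.
set sigma := fss Sy phi _ => sigmaP.
have Ssigma : fsS Sy sigma by apply: fss_fun.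
have Fsigma : fsF Sy sigma by apply: fsS_sub_F.
move=> SAB.
have nAsigma : ~ A sigma.
  move=> Asigma; have /sigmaP[_ [_]] : B sigma by rewrite -SAB.
  by apply; apply/fsg_in_image.
(* Since [B] is assumed equal to the intersection of [S] and [A], [B sigma] would give [A sigma],
   against [nAsigma]. *)
suff : B sigma by rewrite -SAB => -[].
apply/sigmaP; split=> //; split; first exact: gN.
by move/(fsg_in_image _ _ _ _ hA Fsigma).
Qed.
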